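(* Let $(\mathbb U^n)_{n\in\mathbb N}$ be closed convex subsets of $\mathbb H$, let $u_0\in\mathbb U^0$, let $(t_n)_{n\ge 1}$ be a FISTA stepsize, and let $(u_n)$, $(v_n)$ be generated by the refining subset FISTA algorithm, where it is assumed that $u_n\in\mathbb U^{n+1}$ for all $n\in\mathbb N$. Then for any choice of $w_n\in\mathbb U^n$ ($n\in\mathbb N$) and any integer $N\ge 1$, $$t_N^2E_0(u_N)+\sum_{n=1}^{N-1}\rho_nE_0(u_n)+\frac{\|v_N-w_N\|^2}{2}\le\frac{\|u_0-w_0\|^2-\|w_0\|^2+\|w_N\|^2}{2}+\sum_{n=1}^N\Big[t_nE_0(w_n)+\langle v_{n-1},w_{n-1}-w_n\rangle\Big].$$
   Context: Here $\mathbb N=\{0,1,2,\dots\}$. $\mathbb H$ is a real Hilbert space with inner product $\langle\cdot,\cdot\rangle$ and norm $\|\cdot\|$. $f:\mathbb H\to\mathbb R$ is convex and differentiable with $1$-Lipschitz gradient, $g:\mathbb H\to\mathbb R\cup\{+\infty\}$ is proper, convex and weakly lower semicontinuous, $E=f+g$ is bounded below, and $E_0(u)=E(u)-\inf_{\mathbb H}E$ (values in $[0,+\infty]$). FISTA stepsize: a real sequence $(t_n)_{n\ge1}$ with $t_1=1$, $t_n\ge1$ and $\rho_n:=t_n^2-t_{n+1}^2+t_{n+1}\ge0$ for all $n\ge1$. Refining subset FISTA algorithm: given closed convex sets $\mathbb U^n\subset\mathbb H$ (each containing a point where $g$ is finite), $u_0\in\mathbb U^0$ and a FISTA stepsize,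 set $v_0=u_0$ and for $n=0,1,2,\dots$ $$\bar u_n=\Big(1-\tfrac1{t_{n+1}}\Big)u_n+\tfrac1{t_{n+1}}v_n,\qquad u_{n+1}=\operatorname*{argmin}_{u\in\mathbb U^{n+1}}\tfrac12\|u-\bar u_n+\nabla f(\bar u_n)\|^2+g(u),\qquad v_{n+1}=(1-t_{n+1})u_n+t_{n+1}u_{n+1}.$$ *)

(* Defs.v *)
From HB Require Import structures.
From mathcomp Require Import all_boot all_order all_algebra.
From mathcomp Require Import all_classical all_reals all_analysis.

Set Implicit Arguments.
Unset Strict Implicit.
Unset Printing Implicit Defensive.

Import Order.TTheory GRing.Theory Num.Theory.
Import numFieldNormedType.Exports.

Local Open Scope classical_set_scope.
Local Open Scope ring_scope.
Local Open Scope convex_scope.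

(* A real Hilbert space: a complete normed module whose norm is induced by a
   symmetric positive definite bilinear form. *)
HB.mixin Record NormedModule_isHilbert (R : realType) H
    & NormedModule R H := {
  inner : {dot H for @idfun R} ;
  inner_norm : forall x : H, inner x x = `|x| ^+ 2
}.

#[short(type="hilbertType")]
HB.structure Definition Hilbert (R : realType) :=
  {H of CompleteNormedModule R H & NormedModule_isHilbert R H}.

Notation "⟨ x , y ⟩" := (inner x y)
  (at level 0, x at level 99, y at level 99, format "⟨ x ,  y ⟩") : ring_scope.

(* The carrier of H with its weak topology: the coarsest topology for which
   all norm-continuous linear functionals are continuous. *)
Definition weak_space (R : realType) (H : hilbertType R) : Type :=
  sup_topology (fun phi : {phi : {linear H -> R^o} | continuous phi} =>
    Topological.class (initial_topology (sval phi))).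

HB.instance Definition _ (R : realType) (H : hilbertType R) :=
  Topological.on (weak_space H).

Section convex_analysis.
Context {R : realType} {H : hilbertType R}.
Implicit Types (f : H -> R) (g : H -> \bar R) (A : set H).

Definition is_gradient f (x G : H) : Prop :=
  is_diff x (f : H -> R^o) (fun h => ⟨G, h⟩).

(* Properness includes that -oo is not a value: g : H -> R ∪ {+oo}. *)
Definition proper_function g : Prop :=
  (forall x, g x != -oo%E) /\ (exists x, g x \is a fin_num).

(* Jensen's inequality in the extended reals, where 0 * +oo = 0. *)
Definition econvex_function g : Prop :=
  forall (l : {i01 R}) (x y : convex_lmodType H),
    (g (x <| l |> y) <= l%:num%:E * g x + (1 - l%:num)%:E * g y)%E.

Definition weakly_lsc g : Prop :=
  lower_semicontinuous (g : weak_space H -> \bar R).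

Definition energy f g (x : H) : \bar R := ((f x)%:E + g x)%E.

Definition bounded_below g : Prop := exists m : R, forall x, (m%:E <= g x)%E.

Definition energy0 f g (x : H) : \bar R :=
  (energy f g x - ereal_inf (range (energy f g)))%E.

Definition argmin A g : set H :=
  [set x | A x /\ forall y, A y -> (g x <= g y)%E].

End convex_analysis.

Section fista.
Context {R : realType}.
Implicit Type t : nat -> R.

(* Stepsizes are indexed from 1; the value t 0 is never used. *)
Definition fista_rho t (n : nat) : R := t n ^+ 2 - t n.+1 ^+ 2 + t n.+1.

Definition fista_stepsize t : Prop :=
  t 1%N = 1 /\
  (forall n, (1 <= n)%N -> 1 <= t n /\ 0 <= fista_rho t n).

Context {H : hilbertType R}.

Definition fista_bar t (u v : nat -> H) (n : nat) : H :=
  (1 - (t n.+1)^-1) *: u n + (t n.+1)^-1 *: v n.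

(* The iterates (u_n), (v_n), with df the gradient map of the smooth part. By
   strong convexity the minimiser u_{n+1} is unique when it exists. *)
Definition refining_subset_fista (df : H -> H) (g : H -> \bar R)
    (U : nat -> set H) t (u v : nat -> H) : Prop :=
  [/\ v 0%N = u 0%N,
      forall n, argmin (U n.+1)
        (fun x => ((`|x - fista_bar t u v n + df (fista_bar t u v n)| ^+ 2
                    / 2)%:E + g x)%E) (u n.+1) &
      forall n, v n.+1 = (1 - t n.+1) *: u n + t n.+1 *: u n.+1].

End fista.

(* Main.v *)
Require Import Defs.
From HB Require Import structures.
From mathcomp Require Import all_boot all_order all_algebra.
From mathcomp Require Import all_classical all_reals all_analysis.
From mathcomp Require Import ring lra.

Set Implicit Arguments.
Unset Strict Implicit.
Unset Printing Implicit Defensive.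

Import Order.TTheory GRing.Theory Num.Theory.
Import numFieldNormedType.Exports.

Local Open Scope classical_set_scope.
Local Open Scope ring_scope.

(** The estimate rests on one inequality per iteration, followed by a telescoping
    sum.

    A proximal gradient step minimises, over a convex set [A], the quadratic
    [`|y - (a - df a)| ^+ 2 / 2] plus [g].  That objective is 1-strongly convex,
    so it exceeds its minimum at [u] by at least [`|y - u| ^+ 2 / 2] at every
    [y] of [A] ([argmin_prox_le]).  Expanding the squares makes the term
    [⟨df a, u - y⟩] appear.  The tangent plane of [f] at [a], which is a lower
    bound at [y] by convexity ([convex_gradient_le]) and an upper bound at [u] up
    to [`|u - a| ^+ 2 / 2] by the Lipschitz condition ([lipschitz_gradient_le]),
    turns it into a difference of values of [f].  The result
    ([prox_gradient_le]) is
    [E u + `|u - y| ^+ 2 / 2 <= E y + `|y - a| ^+ 2 / 2].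

    FISTA tests this at [y], the convex combination of [w n.+1] and [u n] with
    weights [1 / t n.+1] and [1 - 1 / t n.+1]; it belongs to [U n.+1] because
    [u n] does.  The extrapolation rules are exactly such that [y - a] and
    [u n.+1 - y] are [w n.+1 - v n] and [v n.+1 - w n.+1] divided by [t n.+1], so
    that multiplying by [t n.+1 ^+ 2] gives [fista_step].

    The coefficient [t n.+1 ^+ 2 - t n.+1] of [E (u n)] in that inequality equals
    [t n ^+ 2 - fista_rho t n], and [`|v n - w n.+1| ^+ 2] is re-centred at [w n]
    at the price of the inner product in the conclusion.  Summing over [n] then
    cancels all intermediate terms ([fista_telescope]).

    Infinite values are harmless.  The iterates from [u 1] on have finite energy,
    the energy of [u 0] is multiplied by [t 1 ^+ 2 - t 1 = 0], and if some
    [w n] with [1 <= n <= N] has infinite energy then so does the right-hand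
    side. *)

(** * Inner products and convex combinations *)

Section inner_product.
Context {R : realType} {H : hilbertType R}.
Implicit Types x y z : H.

Lemma innerC x y : ⟨x, y⟩ = ⟨y, x⟩.
Proof. by have := @hermC _ _ _ _ (@inner R H) x y; rewrite expr0 mul1r. Qed.

Lemma innerDl x y z : ⟨x + y, z⟩ = ⟨x, z⟩ + ⟨y, z⟩.
Proof. exact: linearDl. Qed.

Lemma innerDr x y z : ⟨x, y + z⟩ = ⟨x, y⟩ + ⟨x, z⟩.
Proof. exact: linearDr. Qed.

Lemma innerBl x y z : ⟨x - y, z⟩ = ⟨x, z⟩ - ⟨y, z⟩.
Proof. exact: linearBl. Qed.

Lemma innerBr x y z : ⟨x, y - z⟩ = ⟨x, y⟩ - ⟨x, z⟩.
Proof. exact: linearBr. Qed.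

Lemma innerZl (a : R) x y : ⟨a *: x, y⟩ = a * ⟨x, y⟩.
Proof. by rewrite linearZl_LR. Qed.

Lemma innerZr (a : R) x y : ⟨x, a *: y⟩ = a * ⟨x, y⟩.
Proof. by rewrite linearZr_LR. Qed.

Lemma sqr_normD x y : `|x + y| ^+ 2 = `|x| ^+ 2 + 2 * ⟨x, y⟩ + `|y| ^+ 2.
Proof. by rewrite -!inner_norm innerDl !innerDr (innerC y x); ring. Qed.

Lemma sqr_normB x y : `|x - y| ^+ 2 = `|x| ^+ 2 - 2 * ⟨x, y⟩ + `|y| ^+ 2.
Proof. by rewrite -!inner_norm innerBl !innerBr (innerC y x); ring. Qed.

Lemma sqr_normZ (a : R) x : `|a *: x| ^+ 2 = a ^+ 2 * `|x| ^+ 2.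
Proof. by rewrite -!inner_norm innerZl innerZr; ring. Qed.

(** The sign of the squared norm of [`|y| *: x - `|x| *: y] gives the inequality
    multiplied by [`|x| * `|y|]. *)
Lemma cauchy_schwarz x y : ⟨x, y⟩ <= `|x| * `|y|.
Proof.
have [->|x0] := eqVneq x 0; first by rewrite linear0l normr0 mul0r.
have [->|y0] := eqVneq y 0; first by rewrite linear0r normr0 mulr0.
have p : 0 < `|x| * `|y| by rewrite mulr_gt0 ?normr_gt0.
have := sqr_ge0 `| `|y| *: x - `|x| *: y|.
rewrite sqr_normB innerZr innerZl !sqr_normZ => h.
by rewrite -(ler_pM2l p); nra.
Qed.

(** The defect of convexity of the squared norm is exact: this is what makes the
    proximal objective strongly convex. *)
Lemma sqr_norm_conv (s : R) x y :
  `|s *: x + (1 - s) *: y| ^+ 2 =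
  s * `|x| ^+ 2 + (1 - s) * `|y| ^+ 2 - s * (1 - s) * `|x - y| ^+ 2.
Proof. by rewrite sqr_normB sqr_normD !sqr_normZ innerZl innerZr; ring. Qed.

End inner_product.

Lemma conv_expand (R : realType) (V : lmodType R) (s : R)
    (s0 : 0 <= s) (s1 : s <= 1) (x y : V) :
  conv (Itv01 s0 s1) (x : convex_lmodType V) y = s *: x + (1 - s) *: y.
Proof. by []. Qed.

Lemma convex_set_combination (R : realType) (V : lmodType R) (A : set V)
    (s : R) (x y : V) : convex_set A -> 0 <= s -> s <= 1 ->
  A x -> A y -> A (s *: x + (1 - s) *: y).
Proof.
move=> A_convex s0 s1 Ax Ay.
by have := A_convex x y (Itv01 s0 s1); rewrite conv_expand !inE; exact.
Qed.

(** * Tangent plane bounds for the smooth part *)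

Section smooth_convex.
Context {R : realType} {H : hilbertType R} (f : H -> R) (df : H -> H).
Hypothesis f_gradient : forall x, is_gradient f x (df x).

Lemma is_derive_line (x d : H) (s : R) :
  is_derive s 1 (fun r : R => f (x + r *: d) : R^o) ⟨df (x + s *: d), d⟩.
Proof.
have line : is_diff s (cst x + ( *:%R ^~ d) : R -> H) (0 + *:%R ^~ d).
  exact: is_diffD.
have := is_diff_comp line (f_gradient _).
set F := (F in is_diff _ F _) => Fdiff.
have dF : differentiable F s by exact: ex_diff.
have -> : (fun r : R => f (x + r *: d) : R^o) = F by [].
apply: DeriveDef; first exact: diff_derivable.
by rewrite deriveE// diff_val /= fctE add0r scale1r.
Qed.

(** By convexity the difference quotients of [f] from [x] towards [y] are at most
    [f y - f x]; the bound passes to their limit from the right. *)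
Lemma convex_gradient_le : convex_function setT f ->
  forall x y, f x + ⟨df x, y - x⟩ <= f y.
Proof.
move=> f_convex x y.
have [dd dv] := is_derive_line x (y - x) 0.
move: dd dv; rewrite scale0r addr0 => dd dv.
rewrite -lerBrDl -dv.
apply: cvgr_to_le (cvg_dnbhs_at_right dd) _.
near=> s.
have s0 : 0 < s by near: s; exact: nbhs_right_gt.
have s1 : s <= 1 by near: s; exact: nbhs_right_le.
rewrite /= addr0 scale0r addr0 /GRing.scale /= mulr1.
rewrite ler_pdivrMl//.
have := f_convex (Itv01 (ltW s0) s1) y x (in_setT _) (in_setT _).
rewrite convRE !conv_expand /= => fs.
have -> : x + s *: (y - x) = s *: y + (1 - s) *: x.
  by rewrite scalerBr scalerBl scale1r addrCA addrA.
by rewrite /unstable.onem in fs; nra.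
Unshelve. all: by end_near.
Qed.

(** Along the segment from [x] to [y], [phi] is [f] minus the claimed quadratic
    upper bound, up to the constant [f x]; its derivative is nonpositive by the
    Lipschitz condition, so [phi] does not increase from 0 to 1. *)
Lemma lipschitz_gradient_le (L : R) : L.-lipschitz df ->
  forall x y, f y <= f x + ⟨df x, y - x⟩ + L * `|y - x| ^+ 2 / 2.
Proof.
move=> df_lipschitz x y.
set d := y - x.
pose a := ⟨df x, d⟩; pose b := L * `|d| ^+ 2 / 2.
pose phi : R -> R := (fun s => f (x + s *: d)) \- (fun s => s * a + s ^+ 2 * b).
pose dphi s := ⟨df (x + s *: d) - df x, d⟩ - s * (L * `|d| ^+ 2).
have phi_derive (s : R) : is_derive s (1 : R) phi (dphi s).
  have quad : is_derive s (1 : R) (fun s => s * a + s ^+ 2 * b : R)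
      (a + s *+ 2 * b).
    by apply: is_derive_eq; rewrite /GRing.scale /=; ring.
  apply: is_derive_eq (is_deriveB (is_derive_line x d s) quad) _.
  by rewrite /dphi /a /b innerBl; field.
have phi_cont : {within `[0, 1], continuous phi}.
  apply: derivable_within_continuous => s _.
  by have [] := phi_derive s.
have [s s01] := MVT ltr01 (fun s _ => phi_derive s) phi_cont.
have dphi_le0 : dphi s <= 0.
  have s0 : 0 < s by rewrite (itvP s01).
  rewrite subr_le0; apply: le_trans (cauchy_schwarz _ _) _.
  rewrite mulrA expr2 mulrA ler_wpM2r//.
  have := df_lipschitz (x + s *: d, x) (conj I I).
  by rewrite /= [x + _]addrC addrK normrZ gtr0_norm// mulrCA mulrA.
rewrite /phi /= scale0r scale1r addr0 [x + d]addrC subrK subr0 mulr1 => h.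
have : f y - (a + b) - f x <= 0 by nra.
by rewrite /b; lra.
Qed.

End smooth_convex.

(** * The proximal gradient step *)

Section proximal_step.
Context {R : realType} {H : hilbertType R}.
Implicit Types (f : H -> R) (g : H -> \bar R) (A : set H) (x y : H).

(** The weight [s = 1] is allowed with an infinite value at [y], because
    [0 * +oo = 0]; the first FISTA step, where [t 1 = 1] and the energy of [u 0]
    may be infinite, uses this case. *)
Lemma econvex_fin_num g (s : R) x y : 0 <= s -> s <= 1 ->
  proper_function g -> econvex_function g ->
  g x \is a fin_num -> (s = 1 \/ g y \is a fin_num) ->
  g (s *: x + (1 - s) *: y) \is a fin_num /\
  fine (g (s *: x + (1 - s) *: y)) <= s * fine (g x) + (1 - s) * fine (g y).
Proof.
move=> s0 s1 [gNy _] g_convex gx gy.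
have := g_convex (Itv01 s0 s1) x y; rewrite conv_expand /=.
have -> : (s%:E * g x + (1 - s)%:E * g y =
           (s * fine (g x) + (1 - s) * fine (g y))%:E)%E.
  case: gy => [->|gy]; first by rewrite subrr mul0e mul0r adde0 addr0 EFinM fineK.
  by rewrite [RHS]EFinD !EFinM !fineK.
have := gNy (s *: x + (1 - s) *: y).
by case: (g _) => [r| |]//= _; rewrite lee_fin.
Qed.

Lemma argmin_fin_num g (q : H -> R) A (u y : H) : proper_function g ->
  argmin A (fun x => ((q x)%:E + g x)%E) u -> A y -> g y \is a fin_num ->
  g u \is a fin_num.
Proof.
move=> [gNy _] [Au umin] Ay; have := umin y Ay; have := gNy u.
by case: (g u) => [r| |]//; case: (g y).
Qed.

(** Comparing the minimum at [u] with the value at [s *: y + (1 - s) *: u] and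
    dividing by [s] gives the inequality with [`|y - u| ^+ 2 / 2] multiplied by
    [1 - s]; then [s] tends to 0. *)
Lemma argmin_prox_le g A (a u y : H) : proper_function g -> econvex_function g ->
  convex_set A -> argmin A (fun x => ((`|x - a| ^+ 2 / 2)%:E + g x)%E) u ->
  A y -> g y \is a fin_num ->
  `|u - a| ^+ 2 / 2 + fine (g u) + `|y - u| ^+ 2 / 2
    <= `|y - a| ^+ 2 / 2 + fine (g y).
Proof.
move=> g_proper g_convex A_convex u_argmin Ay gy.
have gu := argmin_fin_num g_proper u_argmin Ay gy.
have [Au umin] := u_argmin.
set lhs := (X in X <= _); set rhs := (X in _ <= X).
have h (s : R) : 0 < s -> s <= 1 -> lhs <= rhs + s * (`|y - u| ^+ 2 / 2).
  move=> s0 s1.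
  have [gz gz_le] :=
    econvex_fin_num (ltW s0) s1 g_proper g_convex gy (or_intror gu).
  have := umin _ (convex_set_combination A_convex (ltW s0) s1 Ay Au).
  rewrite -(fineK gu) -(fineK gz) -!EFinD lee_fin.
  have -> : s *: y + (1 - s) *: u - a = s *: (y - a) + (1 - s) *: (u - a).
    by rewrite !scalerBr addrACA -opprD -scalerDl addrCA subrr addr0 scale1r.
  rewrite sqr_norm_conv opprB addrA subrK => hs.
  rewrite -(ler_pM2l s0) /lhs /rhs; nra.
apply/ler_addgt0Pr => e e0.
(* Adding 1 keeps the divisor [c] positive when [y = u]. *)
pose c := `|y - u| ^+ 2 / 2 + 1.
have c1 : 1 <= c by rewrite lerDr mulr_ge0 ?sqr_ge0.
have c0 : 0 < c by lra.
pose s := Num.min 1 (e / c).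
have s0 : 0 < s by rewrite lt_min ltr01 divr_gt0.
have s1 : s <= 1 by rewrite ge_min lexx.
apply: le_trans (h s s0 s1) _; rewrite lerD2l.
have : s * c <= e by rewrite -ler_pdivlMr// ge_min lexx orbT.
by rewrite /c; nra.
Qed.

(** Up to a constant, the objective is the first order model of [f] at [a] plus
    [g] and [`|x - a| ^+ 2 / 2]; convexity and the Lipschitz condition
    compare this model with [f] at [y] and at [u] respectively. *)
Lemma prox_gradient_le f (df : H -> H) g A (a u y : H) :
  convex_function setT f -> (forall x, is_gradient f x (df x)) ->
  1.-lipschitz df -> proper_function g -> econvex_function g -> convex_set A ->
  argmin A (fun x => ((`|x - a + df a| ^+ 2 / 2)%:E + g x)%E) u ->
  A y -> g y \is a fin_num ->
  f u + fine (g u) + `|u - y| ^+ 2 / 2 <= f y + fine (g y) + `|y - a| ^+ 2 / 2.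
Proof.
move=> f_convex f_gradient df_lip g_proper g_convex A_convex u_argmin Ay gy.
have E z : z - a + df a = z - (a - df a) by rewrite opprB addrA [z + _ + _]addrAC.
have {}u_argmin : argmin A
    (fun x => ((`|x - (a - df a)| ^+ 2 / 2)%:E + g x)%E) u.
  by case: u_argmin => Au umin; split=> // z Az; rewrite -!E; exact: umin.
have := argmin_prox_le g_proper g_convex A_convex u_argmin Ay gy.
have := lipschitz_gradient_le f_gradient df_lip a u.
have := convex_gradient_le f_gradient f_convex a y.
rewrite -!E !(sqr_normD _ (df a)) !(innerC (df a)) [`|u - y|]distrC; lra.
Qed.

End proximal_step.

(** * One iteration and the telescoping sum *)

Section fista_step.
Context {R : realType} {H : hilbertType R}.

(** The test point [y] mixes the comparison point [w] into the previous iterate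
    [x] with the weight [t^-1] that mixes [v] into [x] to form [a], so that [x]
    drops out of [y - a]. *)
Lemma fista_step (f : H -> R) (df : H -> H) (g : H -> \bar R) (A : set H)
    (t : R) (x v u w : H) :
  convex_function setT f -> (forall x, is_gradient f x (df x)) ->
  1.-lipschitz df -> proper_function g -> econvex_function g -> convex_set A ->
  1 <= t -> A x -> A w -> g w \is a fin_num -> t = 1 \/ g x \is a fin_num ->
  let a := (1 - t^-1) *: x + t^-1 *: v in
  argmin A (fun y => ((`|y - a + df a| ^+ 2 / 2)%:E + g y)%E) u ->
  t ^+ 2 * (f u + fine (g u)) + `|(1 - t) *: x + t *: u - w| ^+ 2 / 2
  <= (t ^+ 2 - t) * (f x + fine (g x)) + t * (f w + fine (g w))
     + `|v - w| ^+ 2 / 2.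
Proof.
move=> f_convex f_gradient df_lip g_proper g_convex A_convex t1 Ax Aw gw tx a.
have t0 : 0 < t by lra.
have s0 : 0 <= t^-1 by rewrite invr_ge0 ltW.
have s1 : t^-1 <= 1 by rewrite invf_le1.
have tx' : t^-1 = 1 \/ g x \is a fin_num.
  by case: tx => [->|]; [left; rewrite invr1|right].
pose y := t^-1 *: w + (1 - t^-1) *: x.
have [gy gy_le] := econvex_fin_num s0 s1 g_proper g_convex gw tx'.
move=> /(prox_gradient_le f_convex f_gradient df_lip g_proper g_convex A_convex).
move=> /(_ y (convex_set_combination A_convex s0 s1 Aw Ax) gy).
have fy_le : f y <= t^-1 * f w + (1 - t^-1) * f x.
  have := f_convex (Itv01 s0 s1) w x (in_setT _) (in_setT _).
  by rewrite convRE !conv_expand.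
have -> : u - y = t^-1 *: ((1 - t) *: x + t *: u - w).
  have tV : t^-1 * t = 1 by rewrite mulVf// gt_eqF.
  rewrite scalerBr scalerDr !scalerA tV scale1r mulrBr mulr1 tV.
  by rewrite /y -(opprB 1) scaleNr opprD addrA addrAC [- _ + u]addrC.
have -> : y - a = t^-1 *: (w - v).
  by rewrite /y /a scalerBr opprD addrA addrK.
rewrite !sqr_normZ [`|w - v|]distrC -(ler_pM2l (exprn_gt0 2 t0)).
move=> h.
have k : t ^+ 2 * (f y + fine (g y))
    <= t * (f w + fine (g w)) + (t ^+ 2 - t) * (f x + fine (g x)).
  have -> : t * (f w + fine (g w)) + (t ^+ 2 - t) * (f x + fine (g x))
    = t ^+ 2 * (t^-1 * (f w + fine (g w))
        + (1 - t^-1) * (f x + fine (g x))).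
    by field; rewrite gt_eqF.
  by rewrite ler_pM2l ?exprn_gt0//; move: gy_le fy_le; rewrite -/y; lra.
have c z : t ^+ 2 * (t^-1 ^+ 2 * z / 2) = z / 2 by field; rewrite gt_eqF.
by move: h k; rewrite !mulrDr !c; lra.
Qed.
End fista_step.

(** Since [t n.+1 ^+ 2 - t n.+1 = t n ^+ 2 - fista_rho t n], the one-step bounds
    chain once the distance to [w n.+1] is re-centred at [w n].  The chain starts
    without a term in [e 0], whose coefficient vanishes as [t 1 = 1]. *)
Lemma fista_telescope (R : realType) (H : hilbertType R) (t e d : nat -> R)
    (v w : nat -> H) (N : nat) : t 1%N = 1 ->
  (forall n, (n < N.+1)%N ->
    t n.+1 ^+ 2 * e n.+1 + `|v n.+1 - w n.+1| ^+ 2 / 2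
    <= (t n.+1 ^+ 2 - t n.+1) * e n + t n.+1 * d n.+1
       + `|v n - w n.+1| ^+ 2 / 2) ->
  t N.+1 ^+ 2 * e N.+1 + \sum_(1 <= n < N.+1) fista_rho t n * e n
    + `|v N.+1 - w N.+1| ^+ 2 / 2
  <= (`|v 0%N - w 0%N| ^+ 2 - `|w 0%N| ^+ 2 + `|w N.+1| ^+ 2) / 2
     + \sum_(1 <= n < N.+2) (t n * d n + ⟨v n.-1, w n.-1 - w n⟩).
Proof.
move=> t1.
have recentre n : `|v n - w n.+1| ^+ 2 / 2 = `|v n - w n| ^+ 2 / 2
    + (`|w n.+1| ^+ 2 - `|w n| ^+ 2) / 2 + ⟨v n, w n - w n.+1⟩.
  by rewrite !sqr_normB innerBr; field.
elim: N => [|N IHN] step.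
  have := step 0%N isT; rewrite recentre big_geq// big_nat1 /= t1.
  by lra.
have := step N.+1 (leqnn _); rewrite recentre.
have {IHN} := IHN (fun n nN => step n (ltnW nN)).
rewrite [\sum_(1 <= n < N.+2) fista_rho _ _ * _]big_nat_recr//=.
rewrite [\sum_(1 <= n < N.+3) _]big_nat_recr//=.
by rewrite /fista_rho; lra.
Qed.

(** * The energy gap as an extended real *)

Section energy0.
Context {R : realType} {H : hilbertType R} (f : H -> R) (g : H -> \bar R).
Hypotheses (g_proper : proper_function g)
  (E_bounded : bounded_below (energy f g)).

Lemma energy_inf_fin : ereal_inf (range (energy f g)) \is a fin_num.
Proof.
have [m mE] := E_bounded; have [gNy [x gx]] := g_proper.
rewrite fin_numElt; apply/andP; split.
  apply: lt_le_trans (ltNyr m) _.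
  by apply/ereal_infP => _ [y _ <-]; exact: mE.
apply: le_lt_trans (ereal_inf_lbound _) _; first by exists x.
by rewrite /energy -(fineK gx) ltry.
Qed.

Lemma energy0_fin x : g x \is a fin_num ->
  energy0 f g x =
  (f x + fine (g x) - fine (ereal_inf (range (energy f g))))%:E.
Proof.
by move=> gx; rewrite EFinB EFinD !fineK//; exact: energy_inf_fin.
Qed.

Lemma energy0_pinfty x : g x = +oo%E -> energy0 f g x = +oo%E.
Proof.
by move=> gx; rewrite /energy0 /energy gx -(fineK energy_inf_fin).
Qed.

End energy0.

Theorem theorem1 (R : realType) (H : hilbertType R)
    (f : H -> R) (df : H -> H) (g : H -> \bar R)
    (f_convex : convex_function setT f)
    (f_gradient : forall x, is_gradient f x (df x))
    (df_lipschitz : 1.-lipschitz df)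
    (g_proper : proper_function g)
    (g_convex : econvex_function g)
    (g_lsc : weakly_lsc g)
    (E_bounded : bounded_below (energy f g))
    (U : nat -> set H)
    (U_closed : forall n, closed (U n))
    (U_convex : forall n, convex_set (U n))
    (U_finite : forall n, exists2 x, U n x & g x \is a fin_num)
    (t : nat -> R) (t_stepsize : fista_stepsize t)
    (u v : nat -> H) (u0_U0 : U 0%N (u 0%N))
    (uv_fista : refining_subset_fista df g U t u v)
    (u_U : forall n, U n.+1 (u n))
    (w : nat -> H) (w_U : forall n, U n (w n))
    (N : nat) (N_ge1 : (1 <= N)%N) :
  ((t N ^+ 2)%:E * energy0 f g (u N)
   + \sum_(1 <= n < N) (fista_rho t n)%:E * energy0 f g (u n)
   + (`|v N - w N| ^+ 2 / 2)%:E
   <= ((`|u 0%N - w 0%N| ^+ 2 - `|w 0%N| ^+ 2 + `|w N| ^+ 2) / 2)%:E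
   + \sum_(1 <= n < N.+1)
       ((t n)%:E * energy0 f g (w n) + ⟨v n.-1, w n.-1 - w n⟩%:E))%E.
Proof.
case: N N_ge1 => // N _.
have [t1 t_ge] := t_stepsize; have [v0 u_argmin vE] := uv_fista.
have t_ge1 n : 1 <= t n.+1 by have [] := t_ge n.+1 isT.
have gu n : g (u n.+1) \is a fin_num.
  have [x Ux gx] := U_finite n.+1.
  exact: argmin_fin_num g_proper (u_argmin n) Ux gx.
pose m := fine (ereal_inf (range (energy f g))).
(* For [x] of infinite energy, such as possibly [u 0], [e x] is a junk value. *)
pose e x := f x + fine (g x) - m.
have eE x : g x \is a fin_num -> energy0 f g x = (e x)%:E by exact: energy0_fin.
have gw n : g (w n) = +oo%E \/ g (w n) \is a fin_num.
  by have := g_proper.1 (w n); case: (g (w n)) => [r| |]//; [right|left].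
have [w_fin|/existsNP[n /not_implyP[nN gwnN]]] :=
  pselect (forall n, (n < N.+1)%N -> g (w n.+1) \is a fin_num).
- have step n : (n < N.+1)%N ->
      t n.+1 ^+ 2 * e (u n.+1) + `|v n.+1 - w n.+1| ^+ 2 / 2
      <= (t n.+1 ^+ 2 - t n.+1) * e (u n) + t n.+1 * e (w n.+1)
         + `|v n - w n.+1| ^+ 2 / 2.
    move=> nN.
    have tu : t n.+1 = 1 \/ g (u n) \is a fin_num.
      by case: n nN => [|n] _; [left|right].
    have := fista_step f_convex f_gradient df_lipschitz g_proper g_convex
      (U_convex n.+1) (t_ge1 n) (u_U n) (w_U n.+1) (w_fin n nN) tu (u_argmin n).
    by rewrite -vE /e; lra.
  have -> : (\sum_(1 <= n < N.+1) (fista_rho t n)%:E * energy0 f g (u n))%E =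
      (\sum_(1 <= n < N.+1) fista_rho t n * e (u n))%:E.
    rewrite -sumEFin; apply: eq_big_nat => -[//|k] _.
    by rewrite eE// EFinM.
  have -> : (\sum_(1 <= n < N.+2)
        ((t n)%:E * energy0 f g (w n) + ⟨v n.-1, w n.-1 - w n⟩%:E))%E =
      (\sum_(1 <= n < N.+2) (t n * e (w n) + ⟨v n.-1, w n.-1 - w n⟩))%:E.
    rewrite -sumEFin; apply: eq_big_nat => -[//|k] /andP[_ kN].
    by rewrite eE ?w_fin// EFinD EFinM.
  rewrite eE// -!EFinM -!EFinD lee_fin -v0.
  exact: (fista_telescope (e := e \o u) (d := e \o w) t1 step).
- suff -> : (\sum_(1 <= n < N.+2)
      ((t n)%:E * energy0 f g (w n) + ⟨v n.-1, w n.-1 - w n⟩%:E))%E = +oo%E.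
    by rewrite addey// leey.
  rewrite big_seq_cond.
  apply/esum_eqyP => [k|].
    rewrite mem_index_iota andbT; case: k => [//|k] _.
    case: (gw k.+1) => gk; last by rewrite eE.
    rewrite energy0_pinfty// gt0_muley// lte_fin; have := t_ge1 k; lra.
  have gwn : g (w n.+1) = +oo%E by case: (gw n.+1).
  exists n.+1; split; rewrite ?andbT ?mem_index_iota//.
  rewrite energy0_pinfty// gt0_muley// lte_fin; have := t_ge1 n; lra.
Qed.
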